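(* Let $\mathbf{x}_1,\ldots,\mathbf{x}_n$ be independent and identically distributed observations from $\mathcal{N}_p(\mathbf{0},\mathbf{\Sigma})$, and let $\hat{\mathbf{\Sigma}}_1,\ldots,\hat{\mathbf{\Sigma}}_M$ be the associated $p\times p$ order-specific covariance estimates (defined in the context). Fix $\nu>0$, $\lambda\ge 0$ and $\tau>0$. Then, from any starting point $(\mathbf{\Sigma}^0,\mathbf{\Lambda}^0)$, the sequence $(\mathbf{\Sigma}^i,\mathbf{\Phi}^i,\mathbf{\Lambda}^i)$, $i=1,2,\ldots$, generated by \begin{align*} \mathbf{\Phi}^{i+1} &= (\mathbf{\Sigma}^{i}+\tau\mathbf{\Lambda}^{i})_{+},\\ \mathbf{\Sigma}^{i+1} &= \frac{1}{\tau+1}\,\mathbf{s}\Big(\tau\Big(\frac1M\sum_{k=1}^M\hat{\mathbf{\Sigma}}_k-\mathbf{\Lambda}^{i}\Big)+\mathbf{\Phi}^{i+1},\ \lambda\tau\Big),\\ \mathbf{\Lambda}^{i+1} &= \mathbf{\Lambda}^{i}-\frac1\tau(\mathbf{\Phi}^{i+1}-\mathbf{\Sigma}^{i+1}),\qquad i=0,1,2,\ldots \end{align*} converges to an optimal point $(\hat{\mathbf{\Sigma}}^{+},\hat{\mathbf{\Phi}}^{+},\hat{\mathbf{\Lambda}}^{+})$ of $$L(\mathbf{\Sigma},\mathbf{\Phi};\mathbf{\Lambda})=\frac{1}{2M}\sum_{k=1}^M\|\mathbf{\Sigma}-\hat{\mathbf{\Sigma}}_k\|_F^2+\lambda|\mathbf{\Sigma}|_1-\langle\mathbf{\Lambda},\mathbf{\Phi}-\mathbf{\Sigma}\rangle+\frac{1}{2\tau}\|\mathbf{\Phi}-\mathbf{\Sigma}\|_F^2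 ,\qquad \mathbf{\Phi}\succeq\nu\mathbf{I},$$ i.e. $(\hat{\mathbf{\Sigma}}^{+},\hat{\mathbf{\Phi}}^{+})$ is an optimal solution of $$\min_{\mathbf{\Sigma},\mathbf{\Phi}}\Big\{\frac{1}{2M}\sum_{k=1}^M\|\mathbf{\Sigma}-\hat{\mathbf{\Sigma}}_k\|_F^2+\lambda|\mathbf{\Sigma}|_1:\ \mathbf{\Sigma}=\mathbf{\Phi},\ \mathbf{\Phi}\succeq\nu\mathbf{I}\Big\}$$ and $\hat{\mathbf{\Lambda}}^{+}$ is a corresponding optimal dual variable for the constraint $\mathbf{\Sigma}=\mathbf{\Phi}$.
   Context: All matrices $\mathbf{\Sigma}^i,\mathbf{\Phi}^i,\mathbf{\Lambda}^i$ are real symmetric $p\times p$. $\|\cdot\|_F$ is the Frobenius norm, $\langle\mathbf{A},\mathbf{B}\rangle=\sum_{i,j}a_{ij}b_{ij}$, and $|\mathbf{\Sigma}|_1=\sum_{i\ne j}|\sigma_{ij}|$ is the $L_1$ norm of the off-diagonal elements. $\mathbf{A}\succeq\nu\mathbf{I}$ means $\mathbf{A}-\nu\mathbf{I}$ is positive semidefinite; $\nu>0$ is a fixed small number. For a symmetric matrix $\mathbf{Z}=\sum_{i=1}^p\lambda_i\xi_i\xi_i'$ (eigenvalue decomposition with orthonormal column eigenvectors $\xi_i$), $(\mathbf{Z})_+=\sum_{i=1}^p\max(\lambda_i,\nu)\,\xi_i\xi_i'$. For a matrix $\mathbf{Z}=(z_{ij})$ and $\delta\ge0$, $\mathbf{s}(\mathbf{Z},\delta)$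 is the matrix with entries $\operatorname{sign}(z_{ij})\max(|z_{ij}|-\delta,0)$ for $i\ne j$ and $z_{ii}$ on the diagonal. Optimal dual variable: $(\hat{\mathbf{\Sigma}}^+,\hat{\mathbf{\Phi}}^+,\hat{\mathbf{\Lambda}}^+)$ is a primal-dual optimal point if it satisfies the Karush-Kuhn-Tucker conditions: (i) $(-\hat{\mathbf{\Sigma}}^{+}+\frac1M\sum_k\hat{\mathbf{\Sigma}}_k-\hat{\mathbf{\Lambda}}^{+})_{jl}\in\lambda\,\partial|\hat{\mathbf{\Sigma}}^{+}_{jl}|$ for $j\neq l$, where $\partial|\cdot|$ is the subdifferential of the absolute value; (ii) $(-\hat{\mathbf{\Sigma}}^{+}+\frac1M\sum_k\hat{\mathbf{\Sigma}}_k-\hat{\mathbf{\Lambda}}^{+})_{jj}=0$ for all $j$; (iii) $\hat{\mathbf{\Phi}}^{+}=\hat{\mathbf{\Sigma}}^{+}$, $\hat{\mathbf{\Phi}}^{+}\succeq\nu\mathbf{I}$; (iv) $\langle\hat{\mathbf{\Lambda}}^{+},\mathbf{\Phi}-\hat{\mathbf{\Phi}}^{+}\rangle\le0$ for all $\mathbf{\Phi}\succeq\nu\mathbf{I}$. Construction of $\hat{\mathbf{\Sigma}}_k$. Let $\mathbb{X}=(\mathbf{x}_1,\ldots,\mathbf{x}_n)'$ be the $n\times p$ data matrix. Let $\pi_1,\ldots,\pi_M$ be $M$ different permutations of $\{1,\ldots,p\}$ (variable orders) with permutation matrices $\mathbf{P}_{\pi_k}$. For each $k$, reorder the variables by $\pi_k$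 (data matrix $\mathbb{X}\mathbf{P}_{\pi_k}$) and let $\mathbf{x}^{(j)}$ be the $j$th column of the reordered data. Put $\mathbf{e}^{(1)}=\mathbf{x}^{(1)}$ and, for $j=2,\ldots,p$ successively, $\mathbb{Z}^{(j)}=(\mathbf{e}^{(1)},\ldots,\mathbf{e}^{(j-1)})$, $\hat{\mathbf{l}}_j\in\arg\min_{\mathbf{l}_j}\|\mathbf{x}^{(j)}-\mathbb{Z}^{(j)}\mathbf{l}_j\|_2^2+\eta_j\|\mathbf{l}_j\|_1$ with tuning parameter $\eta_j\ge0$, and $\mathbf{e}^{(j)}=\mathbf{x}^{(j)}-\mathbb{Z}^{(j)}\hat{\mathbf{l}}_j$. Let $\hat{\mathbf{L}}_{\pi_k}$ be the unit lower triangular matrix whose $j$th row has subdiagonal entries $\hat{\mathbf{l}}_j$, let $\hat{\mathbf{D}}_{\pi_k}=\mathrm{diag}(\hat d_1^2,\ldots,\hat d_p^2)$ with $\hat d_j^2$ the sample variance of $\mathbf{e}^{(j)}$, and set $\hat{\mathbf{\Sigma}}_{\pi_k}=\hat{\mathbf{L}}_{\pi_k}\hat{\mathbf{D}}_{\pi_k}\hat{\mathbf{L}}_{\pi_k}'$ and $\hat{\mathbf{\Sigma}}_k=\mathbf{P}_{\pi_k}\hat{\mathbf{\Sigma}}_{\pi_k}\mathbf{P}_{\pi_k}'$. *)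

(* Defs.v *)
From HB Require Import structures.
From mathcomp Require Import all_boot all_order all_algebra all_fingroup.
From mathcomp Require Import all_classical all_reals all_analysis.
Set Implicit Arguments.
Unset Strict Implicit.
Unset Printing Implicit Defensive.
Import Order.TTheory GRing.Theory Num.Theory.
Import numFieldNormedType.Exports.
Local Open Scope classical_set_scope.
Local Open Scope ring_scope.

Section matrices.
Variable R : realType.

Definition frob_inner m n (A B : 'M[R]_(m, n)) : R :=
  \sum_i \sum_j A i j * B i j.

Definition frob_norm m n (A : 'M[R]_(m, n)) : R :=
  Num.sqrt (\sum_i \sum_j A i j ^+ 2).

Definition offdiag_l1 p (A : 'M[R]_p) : R :=
  \sum_i \sum_(j | i != j) `|A i j|.

Definition psdmx p (A : 'M[R]_p) : Prop :=
  A \is symmetricmx /\ forall v : 'cV[R]_p, 0 <= (v^T *m A *m v) 0 0.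

Definition succeq_nuI p (nu : R) (A : 'M[R]_p) : Prop := psdmx (A - nu%:M).

Definition rank1_sum p (lam : 'rV[R]_p) (Q : 'M[R]_p) : 'M[R]_p :=
  \sum_i lam 0 i *: (col i Q *m (col i Q)^T).

Definition is_eigen_decomposition p (Z : 'M[R]_p) (e : 'rV[R]_p * 'M[R]_p) :=
  e.2^T *m e.2 = 1%:M /\ Z = rank1_sum e.1 e.2.

(* One eigenvalue decomposition is chosen; the default value is only reached
   when [Z] is not symmetric. *)
Definition eigen_decomposition p (Z : 'M[R]_p) : 'rV[R]_p * 'M[R]_p :=
  xget (0, 1%:M) [set e | is_eigen_decomposition Z e].

(* (Z)_+ ; it does not depend on the decomposition chosen. *)
Definition plus_part p (nu : R) (Z : 'M[R]_p) : 'M[R]_p :=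
  let: (lam, Q) := eigen_decomposition Z in
  rank1_sum (\row_i Num.max (lam 0 i) nu) Q.

Definition soft_threshold p (Z : 'M[R]_p) (delta : R) : 'M[R]_p :=
  \matrix_(i, j) if i == j then Z i j
                 else Num.sg (Z i j) * Num.max (`|Z i j| - delta) 0.

Definition subdifferential (f : R -> R) (x : R) : set R :=
  [set g | forall y, f x + g * (y - x) <= f y].

End matrices.

Section optimization.
Variables (R : realType) (p M : nat).
Variables (Sighat : 'I_M -> 'M[R]_p) (nu lambda : R).

Definition mean_estimate : 'M[R]_p := M%:R^-1 *: \sum_k Sighat k.

Definition objective (Sig : 'M[R]_p) : R :=
  (2 * M%:R)^-1 * (\sum_k frob_norm (Sig - Sighat k) ^+ 2)
  + lambda * offdiag_l1 Sig.

Definition feasible (Sig Phi : 'M[R]_p) : Prop :=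
  [/\ Sig \is symmetricmx, Sig = Phi & succeq_nuI nu Phi].

Definition optimal_solution (Sig Phi : 'M[R]_p) : Prop :=
  feasible Sig Phi /\
  forall Sig' Phi', feasible Sig' Phi' -> objective Sig <= objective Sig'.

(* The Karush-Kuhn-Tucker conditions for the multiplier [Lam] of Sig = Phi. *)
Definition primal_dual_optimal (Sig Phi Lam : 'M[R]_p) : Prop :=
  let G := - Sig + mean_estimate - Lam in
  [/\ Sig \is symmetricmx /\ Lam \is symmetricmx,
      forall j l, j != l ->
        G j l \in [set lambda * g | g in subdifferential Num.norm (Sig j l)],
      forall j, G j j = 0,
      Phi = Sig /\ succeq_nuI nu Phi
    & forall Phi' : 'M[R]_p, succeq_nuI nu Phi' ->
        frob_inner Lam (Phi' - Phi) <= 0].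

(* Phi 0 is unconstrained: the iteration only uses Sig 0 and Lam 0. *)
Definition admm_iteration (tau : R) (Sig Phi Lam : nat -> 'M[R]_p) : Prop :=
  forall i,
  [/\ Phi i.+1 = plus_part nu (Sig i + tau *: Lam i),
      Sig i.+1 = (tau + 1)^-1 *:
        soft_threshold (tau *: (mean_estimate - Lam i) + Phi i.+1)
                       (lambda * tau)
    & Lam i.+1 = Lam i - tau^-1 *: (Phi i.+1 - Sig i.+1)].

End optimization.

Section order_specific_estimate.
Variables (R : realType) (n p : nat).

Definition l2norm m (v : 'cV[R]_m) : R := Num.sqrt (\sum_i v i 0 ^+ 2).

Definition l1norm m (v : 'cV[R]_m) : R := \sum_i `|v i 0|.

(* Column j of X *m order_mx s is column s j of X, whereas
   perm_mx s has its ones at the entries (i, s i). *)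
Definition order_mx (s : 'S_p) : 'M[R]_p := perm_mx s^-1.

Definition before (j : 'I_p) (k : 'I_j) : 'I_p :=
  widen_ord (ltnW (ltn_ord j)) k.

(* The n x j matrix of the columns of E of index < j. *)
Definition previous_cols (E : 'M[R]_(n, p)) (j : 'I_p) : 'M[R]_(n, j) :=
  \matrix_(i, k) E i (before k).

(* The subdiagonal entries of row j of L, as a column vector. *)
Definition subdiag_row (L : 'M[R]_p) (j : 'I_p) : 'cV[R]_j :=
  \col_k L j (before k).

Definition lasso_objective m (y : 'cV[R]_n) (Z : 'M[R]_(n, m)) (eta : R)
    (l : 'cV[R]_m) : R :=
  l2norm (y - Z *m l) ^+ 2 + eta * l1norm l.

Definition lasso_argmin m (y : 'cV[R]_n) (Z : 'M[R]_(n, m)) (eta : R) :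
    set 'cV[R]_m :=
  [set l | forall l', lasso_objective y Z eta l <= lasso_objective y Z eta l'].

(* Centred, with the unbiased normalisation 1 / (n - 1). *)
Definition sample_variance (e : 'cV[R]_n) : R :=
  let mean := n%:R^-1 * \sum_i e i 0 in
  (n.-1)%:R^-1 * \sum_i (e i 0 - mean) ^+ 2.

(* A relation and not a function of the data, because the lasso problems may
   have several minimizers. *)
Definition is_order_estimate (X : 'M[R]_(n, p)) (s : 'S_p) (eta : 'I_p -> R)
    (S : 'M[R]_p) : Prop :=
  let Y := X *m order_mx s in
  exists (L : 'M[R]_p) (E : 'M[R]_(n, p)),
  [/\ is_trig_mx L,
      forall j, L j j = 1,
      forall j,
        subdiag_row L j \in lasso_argmin (col j Y) (previous_cols E j) (eta j),
      forall j, col j E = col j Y - previous_cols E j *m subdiag_row L j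
    & let D := diag_mx (\row_j sample_variance (col j E)) in
      S = order_mx s *m (L *m D *m L^T) *m (order_mx s)^T].

End order_specific_estimate.

Section sampling.
Variables (R : realType) (d : measure_display) (T : measurableType d).
Variable P : probability T R.

Definition mutually_independent d' (T' : measurableType d') n
    (X : 'I_n -> {RV P >-> T'}) : Prop :=
  forall (J : {set 'I_n}) (B : 'I_n -> set T'),
    (forall i, measurable (B i)) ->
    P (\bigcap_(i in [set` J]) (X i @^-1` B i)) =
    (\prod_(i in J) P (X i @^-1` B i))%E.

(* N(0, v), which is the Dirac mass at 0 when v = 0; [normal_prob] takes the
   standard deviation and is not that Dirac mass at standard deviation 0. *)
Definition centered_normal (v : R) (A : set R) : \bar R :=
  if v == 0 then \d_(0 : R) A else normal_prob 0 (Num.sqrt v) A.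

(* N_p(0, Sigma), possibly degenerate: every linear combination c of the
   coordinates follows N(0, c Sigma c'). *)
Definition normal_vector p (X : {RV P >-> p.-tuple R}) (Sigma : 'M[R]_p) :=
  psdmx Sigma /\
  forall (c : 'rV[R]_p) (A : set R), measurable A ->
    P ((fun w => \sum_j c 0 j * tnth (X w) j) @^-1` A) =
    centered_normal ((c *m Sigma *m c^T) 0 0) A.

Definition iid_normal_sample n p (x : 'I_n -> {RV P >-> p.-tuple R})
    (Sigma : 'M[R]_p) : Prop :=
  mutually_independent x /\ forall i, normal_vector (x i) Sigma.

Definition data_matrix n p (x : 'I_n -> {RV P >-> p.-tuple R}) (w : T) :
    'M[R]_(n, p) :=
  \matrix_(i, j) tnth (x i w) j.

End sampling.

(* Main.v *)
Require Import Defs.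
From HB Require Import structures.
From mathcomp Require Import all_boot all_order all_algebra all_fingroup.
From mathcomp Require Import all_classical all_reals all_analysis.
From mathcomp Require Import ring lra.
Import Order.TTheory GRing.Theory Num.Theory.
Import numFieldNormedType.Exports.
Local Open Scope classical_set_scope.
Local Open Scope ring_scope.

(** Write [S] for the mean of the estimates [Sighat k] and [C] for the set of
    the matrices with [succeq_nuI nu]. The estimates enter only through [S],
    which is symmetric whatever the data: by [quadratic_loss_expand] the loss is
    [|Sigma - S|^2 / 2] up to a constant. The problem is therefore to minimize a
    strongly convex function over [C], and the iteration is the alternating
    direction method for it.

    Each step is a proximal step. The spectral theorem shows that [plus_part] is
    the projection onto [C] ([plus_partP]), and soft-thresholding solves the
    minimization in Sigma, so that with the updated multiplier
    [- Sig i.+1 + S - Lam i.+1] is a subgradient of [lambda |.|_1] at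
    [Sig i.+1] ([admm_subgrad]). Let [(X, L)] be a saddle point, that is a
    solution of the Karush-Kuhn-Tucker conditions with Phi eliminated. Since
    subdifferentials and normal cones are monotone, the merit function
    [|Sig i - X|^2 + tau^2 |Lam i - L|^2] decreases from the first step on, each
    time by at least
    [2 tau |Sig i.+1 - X|^2 + tau^2 |Lam i - Lam i.+1|^2] ([merit_decrease]).
    The decrements tend to 0; hence [Sig i] tends to [X], and so does [Phi i],
    which differs from [Sig i] by [tau (Lam i.-1 - Lam i)].

    The multiplier is not unique, so [Lam i] need not tend to the [L] one
    started from. But [Lam i] is bounded and has a limit [L'] along an
    ultrafilter that refines the convergence to infinity, which replaces a
    subsequence; the optimality conditions pass to that limit, so [(X, L')] is a
    saddle point. The merit function built with [L'] is monotone and tends to 0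
    along the ultrafilter, hence tends to 0, and [Lam i] tends to [L']
    ([admm_cvg]). As a limit of symmetric matrices [L'] is symmetric.

    A saddle point exists ([saddle_point_exists]) because the dual function
    attains its maximum over the compact box of all possible subgradients; this
    avoids any constraint qualification. Compactness of boxes is also what gives
    the minimum of a quadratic form on the unit sphere, from which the spectral
    theorem is derived. *)

Set Implicit Arguments.
Unset Strict Implicit.

(** * The Frobenius inner product *)

Section frobenius.
Context {R : realType} {m n : nat}.
Implicit Types A B C : 'M[R]_(m, n).

Lemma frob_innerE A B : frob_inner A B = \tr (A^T *m B).
Proof.
rewrite /frob_inner exchange_big; apply: eq_bigr => j _; rewrite mxE.
by apply: eq_bigr => i _; rewrite mxE.
Qed.

Lemma frob_innerC A B : frob_inner A B = frob_inner B A.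
Proof. by apply: eq_bigr => i _; apply: eq_bigr => j _; rewrite mulrC. Qed.

Lemma frob_innerDl A B C : frob_inner (A + B) C = frob_inner A C + frob_inner B C.
Proof. by rewrite !frob_innerE linearD mulmxDl linearD. Qed.

Lemma frob_innerZl a A C : frob_inner (a *: A) C = a * frob_inner A C.
Proof. by rewrite !frob_innerE linearZ -scalemxAl linearZ. Qed.

Lemma frob_innerNl A C : frob_inner (- A) C = - frob_inner A C.
Proof. by rewrite -scaleN1r frob_innerZl mulN1r. Qed.

Lemma frob_innerDr A B C : frob_inner C (A + B) = frob_inner C A + frob_inner C B.
Proof. by rewrite !(frob_innerC C) frob_innerDl. Qed.

Lemma frob_innerZr a A C : frob_inner C (a *: A) = a * frob_inner C A.
Proof. by rewrite !(frob_innerC C) frob_innerZl. Qed.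

Lemma frob_innerNr A C : frob_inner C (- A) = - frob_inner C A.
Proof. by rewrite !(frob_innerC C) frob_innerNl. Qed.

Lemma frob_inner0r C : frob_inner C 0 = 0.
Proof. by rewrite -[X in frob_inner _ X](scale0r C) frob_innerZr mul0r. Qed.

Definition frob_bilin := (frob_innerDl, frob_innerDr, frob_innerNl, frob_innerNr,
  frob_innerZl, frob_innerZr).

Lemma frob_inner_sumr I (r : seq I) (F : I -> 'M[R]_(m, n)) C :
  frob_inner C (\sum_(i <- r) F i) = \sum_(i <- r) frob_inner C (F i).
Proof.
apply: (big_morph (frob_inner C)); last exact: frob_inner0r.
by move=> A B; exact: frob_innerDr.
Qed.

Lemma frob_inner_ge0 A : 0 <= frob_inner A A.
Proof. by apply: sumr_ge0 => i _; apply: sumr_ge0 => j _; exact: sqr_ge0. Qed.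

Lemma frob_norm_sqr A : frob_norm A ^+ 2 = frob_inner A A.
Proof. exact/sqr_sqrtr/frob_inner_ge0. Qed.

Lemma frob_young t A B :
  2 * t * frob_inner A B <= t ^+ 2 * frob_inner A A + frob_inner B B.
Proof.
have := frob_inner_ge0 (t *: A - B).
rewrite !frob_bilin (frob_innerC B A); nra.
Qed.

Lemma sqr_coord_le A i j : A i j ^+ 2 <= frob_inner A A.
Proof.
rewrite /frob_inner (bigD1 i)//= (bigD1 j)//= -expr2 -addrA lerDl addr_ge0//.
  by apply: sumr_ge0 => k _; exact: sqr_ge0.
by apply: sumr_ge0 => k _; apply: sumr_ge0 => l _; exact: sqr_ge0.
Qed.

Lemma frob_inner_eq0 A : frob_inner A A = 0 -> A = 0.
Proof.
move=> A0; apply/matrixP => i j; rewrite mxE; apply/eqP.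
by rewrite -sqrf_eq0 eq_le sqr_ge0 -A0 sqr_coord_le.
Qed.

End frobenius.

Lemma frob_inner_mull {R : realType} m n k (A : 'M[R]_(m, k)) (B : 'M[R]_(k, n))
  (C : 'M[R]_(m, n)) : frob_inner (A *m B) C = frob_inner B (A^T *m C).
Proof. by rewrite !frob_innerE trmx_mul mulmxA. Qed.

Lemma frob_inner_mulr {R : realType} m n k (A : 'M[R]_(m, k)) (B : 'M[R]_(k, n))
  (C : 'M[R]_(m, n)) : frob_inner (A *m B) C = frob_inner A (C *m B^T).
Proof.
by rewrite !frob_innerE trmx_mul -mulmxA mxtrace_mulC mulmxA.
Qed.

Lemma frob_inner_tr {R : realType} m n (A B : 'M[R]_(m, n)) :
  frob_inner A^T B^T = frob_inner A B.
Proof.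
rewrite /frob_inner exchange_big; apply: eq_bigr => i _; apply: eq_bigr => j _.
by rewrite !mxE.
Qed.

Lemma frob_inner_cV {R : realType} n (u v : 'cV[R]_n) :
  u^T *m v = (frob_inner u v)%:M.
Proof.
apply/matrixP => i j; rewrite !ord1 !mxE mulr1n; apply: eq_bigr => k _.
by rewrite big_ord1 mxE.
Qed.

Lemma quad_form_frob {R : realType} n (A : 'M[R]_n) (v : 'cV[R]_n) :
  (v^T *m A *m v) 0 0 = frob_inner v (A *m v).
Proof. by rewrite -mulmxA frob_inner_cV mxE mulr1n. Qed.

Lemma frob_inner_diag {R : realType} p (d : 'rV[R]_p) (A : 'M[R]_p) :
  frob_inner (diag_mx d) A = \sum_i d 0 i * A i i.
Proof.
apply: eq_bigr => i _; rewrite (bigD1 i)//= big1 ?addr0 ?mxE ?eqxx//.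
by move=> j ji; rewrite mxE eq_sym (negbTE ji) mul0r.
Qed.

Lemma symmetricmxE {R : realType} p (A : 'M[R]_p) :
  (A \is symmetricmx) = (A^T == A).
Proof.
rewrite is_hermitianmxE expr0 scale1r eq_sym.
by congr (_ == _); apply/matrixP => i j; rewrite !mxE.
Qed.

(** * Entrywise convergence and compactness of matrices *)

Section matrix_convergence.
Context {R : realType} {I : Type} {F : set_system I} {FF : Filter F}.

Lemma cvg_mxP m n (A : I -> 'M[R]_(m, n)) (B : 'M[R]_(m, n)) :
  A x @[x --> F] --> B <-> forall i j, A x i j @[x --> F] --> B i j.
Proof.
split=> [AB i j|AB].
  have Bij := @coord_continuous R m n i j B.
  by move=> V /Bij /AB.
move=> V [P BP PV]; rewrite /fmap /=.
have : \forall x \near F, forall ij : 'I_m * 'I_n, P ij.1 ij.2 (A x ij.1 ij.2).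
  apply: filter_forall => -[k l] /=; exact: AB.
by apply: filterS => x Px; apply: PV => i j; exact: (Px (i, j)).
Qed.

Lemma cvg_frob_inner m n (A B : I -> 'M[R]_(m, n)) a b :
  A x @[x --> F] --> a -> B x @[x --> F] --> b ->
  frob_inner (A x) (B x) @[x --> F] --> frob_inner a b.
Proof.
move=> /cvg_mxP Aa /cvg_mxP Bb.
apply: cvg_big => [|i _]; first exact: add_continuous.
apply: cvg_big => [|j _]; first exact: add_continuous.
exact: cvgM.
Qed.

Lemma cvg_mulmxr m n k (C : 'M[R]_(m, n)) (A : I -> 'M[R]_(n, k)) a :
  A x @[x --> F] --> a -> C *m A x @[x --> F] --> C *m a.
Proof.
move=> /cvg_mxP Aa; apply/cvg_mxP => i j; rewrite mxE.
under eq_fun do rewrite mxE.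
apply: cvg_big => [|l _]; first exact: add_continuous.
by apply: cvgM; [exact: cvg_cst|exact: Aa].
Qed.

Lemma cvg_frob0 m n (A : I -> 'M[R]_(m, n)) (B : 'M[R]_(m, n)) :
  frob_inner (A x - B) (A x - B) @[x --> F] --> 0 -> A x @[x --> F] --> B.
Proof.
move=> AB; apply/cvg_mxP => i j; apply/cvgrPdist_lt => e e0.
move/cvgr0Pnorm_lt : AB => /(_ (e ^+ 2) (exprn_gt0 _ e0)); apply: filterS => x.
rewrite ger0_norm ?frob_inner_ge0// => /(le_lt_trans (sqr_coord_le _ i j)).
by rewrite !mxE distrC -real_normK ?num_real// ltr_pXn2r// nnegrE ?normr_ge0// ltW.
Qed.

End matrix_convergence.

Lemma cvgr_unique {R : realType} {I : Type} {F : set_system I}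
    {FF : ProperFilter F} (f : I -> R) (a b : R) :
  f x @[x --> F] --> a -> f x @[x --> F] --> b -> a = b.
Proof. by move=> fa fb; exact: (cvg_unique (@Rhausdorff R) fa fb). Qed.

(** An ultrafilter decides membership of every neighbourhood, so that a cluster
    point of an ultrafamily is already its limit. *)
Lemma ultra_cvg_compact {I : Type} {U : set_system I} {T : topologicalType}
    (UU : UltraFilter U) (u : I -> T) (K : set T) :
  compact K -> (\forall i \near U, K (u i)) ->
  exists2 c, K c & u i @[i --> U] --> c.
Proof.
move=> cK uK; have [c [Kc uc]] := cK (u @ U) _ uK.
exists c => // V cV.
have [//|UnV] := in_ultra_setVsetC (u @^-1` V) UU.
by have [y []] := uc (~` V) V UnV cV.
Qed.

(** Tychonoff's theorem for finitely many segments, by ultrafilters. *)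
Lemma compact_mx_box {R : realType} m n (b : 'I_m -> 'I_n -> R) :
  compact [set A : 'M[R]_(m, n) | forall i j, `|A i j| <= b i j].
Proof.
rewrite compact_ultra => /= U UU Ub.
have Uc i j : exists2 c, `[- b i j, b i j]%classic c &
    (fun M : 'M[R]_(m, n) => M i j) @ U --> c.
  apply: ultra_cvg_compact; first exact: segment_compact.
  by apply: filterS Ub => M /(_ i j); rewrite /= in_itv /= ler_norml.
pose c : 'M[R]_(m, n) := \matrix_(i, j) projT1 (cid2 (Uc i j)).
exists c; split=> [i j|]; rewrite /=.
  by rewrite mxE; case: cid2 => x /=; rewrite in_itv /= ler_norml.
apply/(@cvg_mxP R _ U _ m n id) => i j; rewrite mxE.
by case: cid2.
Qed.

(** * The spectral theorem for real symmetric matrices *)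

Lemma rank1_sumE {R : realType} p (lam : 'rV[R]_p) (Q : 'M[R]_p) :
  rank1_sum lam Q = Q *m diag_mx lam *m Q^T.
Proof.
apply/matrixP => i j; rewrite /rank1_sum summxE mxE; apply: eq_bigr => k _.
rewrite !mxE big_ord1 (bigD1 k)//= big1 => [|l lk]; last first.
  by rewrite !mxE (negbTE lk) mulr0n mulr0.
by rewrite !mxE eqxx mulr1n addr0 mulrA [lam 0 k * _]mulrC.
Qed.

(** Otherwise [t = - b / (|q| + 1)] would make the right-hand side a negative
    multiple of [b ^+ 2]. *)
Lemma quadratic_ge0_linear0 {R : realType} (b q : R) :
  (forall t, 0 <= t * b + t ^+ 2 * q) -> b = 0.
Proof.
move=> bq; set k := `|q| + 1.
have k0 : 0 < k by rewrite ltr_wpDl.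
have := bq (- b / k).
have -> : - b / k * b + (- b / k) ^+ 2 * q = (b / k) ^+ 2 * (q - k).
  by field; rewrite gt_eqF.
have qk : q - k < 0 by rewrite /k; have := ler_norm q; lra.
rewrite nmulr_lge0// => bk; apply/eqP.
have : (b / k) ^+ 2 == 0 by rewrite eq_le bk sqr_ge0.
by rewrite sqrf_eq0 mulf_eq0 invr_eq0 (gt_eqF k0) orbF.
Qed.

(** The minimum [a] of the quadratic form on the unit sphere is an eigenvalue:
    [A - a] is nonnegative and its form vanishes at a minimizer [u], hence so
    does the first order term in every direction, in particular in the
    direction [A u - a u]. *)
Lemma symmetric_eigenvector {R : realType} n (A : 'M[R]_n.+1) : A^T = A ->
  exists (u : 'cV[R]_n.+1) a, frob_inner u u = 1 /\ A *m u = a *: u.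
Proof.
move=> symA; pose S : set 'cV[R]_n.+1 := [set u | frob_inner u u = 1].
have cS : compact S.
  apply: (@subclosed_compact _ S [set u | forall i j, `|u i j| <= 1]).
  - apply: (@closed_comp _ _ (fun u : 'cV[R]_n.+1 => frob_inner u u) [set 1]).
      by move=> u _; apply: (@cvg_frob_inner R _ (nbhs u) _ _ _ id id).
    exact: closed_eq.
  - exact: (@compact_mx_box R _ _ (fun _ _ => 1)).
  - move=> u uS i j; rewrite -(@ler_pXn2r _ 2)// ?nnegrE// expr1n real_normK ?num_real//.
    by rewrite -uS sqr_coord_le.
have S0 : S !=set0.
  exists (delta_mx 0 0); rewrite /S /= /frob_inner (bigD1 0)//= big_ord1 !mxE !eqxx/=.
  rewrite big1 ?addr0 ?mulr1// => i i0.
  by rewrite big_ord1 !mxE (negbTE i0) mul0r.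
have [|u /set_mem uS umin] := compact_EVT_min (f := fun u => frob_inner u (A *m u)) S0 cS.
  apply: continuous_subspaceT => u.
  apply: (@cvg_frob_inner R _ (nbhs u) _ _ _ id (mulmx A)) => //.
  exact: (@cvg_mulmxr R _ (nbhs u) _ _ _ _ A id).
set a := frob_inner u (A *m u) in umin.
exists u, a; split=> //.
pose B := A - a%:M.
have BE (v : 'cV[R]_n.+1) : B *m v = A *m v - a *: v by rewrite mulmxBl mul_scalar_mx.
have B_ge0 (v : 'cV[R]_n.+1) : 0 <= frob_inner v (B *m v).
  have [->|v0] := eqVneq v 0; first by rewrite mulmx0 frob_inner0r.
  have vv : 0 < frob_inner v v.
    rewrite lt_neqAle frob_inner_ge0 andbT eq_sym.
    by apply: contra v0 => /eqP /frob_inner_eq0 ->.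
  set c := Num.sqrt (frob_inner v v).
  have c0 : 0 < c by rewrite sqrtr_gt0.
  have c2 : c ^+ 2 = frob_inner v v by rewrite sqr_sqrtr// ltW.
  have /umin : c^-1 *: v \in S.
    apply/mem_set; rewrite /S /= !frob_bilin -c2.
    by field; rewrite gt_eqF.
  rewrite BE -scalemxAr !frob_bilin -c2 mulrA -expr2 exprVn.
  by rewrite ler_pdivlMl ?exprn_gt0// subr_ge0 mulrC.
have symB : B^T = B by rewrite /B linearB /= symA tr_scalar_mx.
have Bu0 : frob_inner u (B *m u) = 0.
  by rewrite BE !frob_bilin (uS : frob_inner u u = 1) mulr1 subrr.
suff : frob_inner (B *m u) (B *m u) = 0.
  by move/frob_inner_eq0/eqP; rewrite BE subr_eq0 => /eqP.
set w := B *m u.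
apply: (@quadratic_ge0_linear0 _ _ (frob_inner w (B *m w) / 2)) => t.
have := B_ge0 (u + t *: w).
have uw : frob_inner u (B *m w) = frob_inner w w.
  by rewrite /w frob_innerC frob_inner_mull symB.
rewrite mulmxDr -scalemxAr -/w !frob_bilin uw.
rewrite (frob_innerC u w) frob_innerC -/w in Bu0 *.
nra.
Qed.

(** The Householder reflection in the hyperplane orthogonal to [u - e]. *)
Lemma householder {R : realType} n (u e : 'cV[R]_n) :
  frob_inner u u = 1 -> frob_inner e e = 1 ->
  exists H : 'M[R]_n, [/\ H^T = H, H *m H = 1%:M & H *m e = u].
Proof.
move=> uu ee; have [<-|ue] := eqVneq u e.
  by exists 1%:M; rewrite trmx1 !mul1mx.
pose w := u - e; pose c := frob_inner w w.
have c0 : c != 0 by apply: contra ue => /eqP/frob_inner_eq0/eqP; rewrite subr_eq0.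
have we : frob_inner w e = - c / 2.
  rewrite /c /w !frob_bilin uu ee (frob_innerC e u); lra.
exists (1%:M - (2 / c) *: (w *m w^T)); split.
- by rewrite linearB linearZ /= trmx1 trmx_mul trmxK.
- have ww : (w *m w^T) *m (w *m w^T) = c *: (w *m w^T).
    by rewrite mulmxA -(mulmxA w) frob_inner_cV -/c mul_mx_scalar scalemxAl.
  rewrite mulmxBl mul1mx mulmxBr mulmx1 -scalemxAl -scalemxAr ww -scalerBr.
  have -> : w *m w^T - (2 / c) *: (c *: (w *m w^T)) = - (w *m w^T).
    by rewrite scalerA divfK// scaler_nat mulr2n opprD addNKr.
  by rewrite scalerN opprK subrK.
- rewrite mulmxBl mul1mx -scalemxAl -mulmxA frob_inner_cV mul_mx_scalar scalerA we.
  have -> : 2 / c * (- c / 2) = -1 by field.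
  by rewrite scaleN1r opprK /w addrC subrK.
Qed.

(** Induction on the dimension: in an orthonormal basis whose first vector is
    an eigenvector, a symmetric matrix is block diagonal. *)
Lemma spectral_decomposition {R : realType} p (Z : 'M[R]_p) : Z^T = Z ->
  exists (lam : 'rV[R]_p) (Q : 'M[R]_p), Q^T *m Q = 1%:M /\ Z = Q *m diag_mx lam *m Q^T.
Proof.
elim: p Z => [|p IH] Z symZ.
  by exists 0, 1%:M; split; apply/matrixP => -[].
have [u [a [uu Zu]]] := @symmetric_eigenvector _ _ _ symZ.
pose e : 'cV[R]_(1 + p) := col_mx 1%:M 0.
have ee : frob_inner e e = 1.
  have := frob_inner_cV e e; rewrite tr_col_mx mul_row_col trmx1 mul1mx mulmx0 addr0.
  by move=> /matrixP/(_ 0 0); rewrite !mxE.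
have [H [symH HH He]] := householder uu ee.
pose B : 'M[R]_(1 + p) := H *m Z *m H.
have symB : B^T = B by rewrite /B !trmx_mul symH symZ mulmxA.
have Be : B *m e = a *: e.
  by rewrite -mulmxA He -mulmxA Zu -scalemxAr -He mulmxA HH mul1mx.
have [Bul Bdl] : ulsubmx B = a%:M /\ dlsubmx B = 0.
  move: Be; rewrite -[B]submxK mul_block_col !mulmx1 !mulmx0 !addr0.
  rewrite submxK scale_col_mx scaler0 => /eq_col_mx[-> ->].
  by rewrite scale_scalar_mx mulr1.
have Bur : ursubmx B = 0 by rewrite -[B]symB -trmx_dlsub Bdl trmx0.
have [mu [Q [QQ Bdr]]] := IH (drsubmx B) (etrans (trmx_drsub B) (congr1 drsubmx symB)).
pose Q' : 'M[R]_(1 + p) := block_mx 1%:M 0 0 Q.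
have BE : B = Q' *m diag_mx (row_mx a%:M mu) *m Q'^T.
  rewrite -[B]submxK Bul Bdl Bur Bdr diag_mx_row /Q' tr_block_mx !mulmx_block.
  rewrite !(mulmx0, mul0mx, addr0, add0r, trmx0, trmx1, mul1mx, mulmx1).
  by congr block_mx; apply/matrixP => i j; rewrite !ord1 !mxE eqxx.
have QQ' : Q'^T *m Q' = 1%:M.
  rewrite /Q' tr_block_mx mulmx_block.
  rewrite !(mulmx0, mul0mx, addr0, add0r, trmx0, trmx1, mul1mx, mulmx1) QQ.
  by rewrite -scalar_mx_block.
exists (row_mx a%:M mu), (H *m Q'); split.
  by rewrite trmx_mul symH mulmxA -(mulmxA _ H H) HH mulmx1.
have -> : Z = H *m B *m H by rewrite /B !mulmxA HH mul1mx -mulmxA HH mulmx1.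
by rewrite BE trmx_mul symH !mulmxA.
Qed.

(** * Projection onto the matrices whose eigenvalues are at least [nu] *)

Lemma eigen_decompositionP {R : realType} p (Z : 'M[R]_p) :
  Z^T = Z -> is_eigen_decomposition Z (eigen_decomposition Z).
Proof.
move=> /spectral_decomposition[lam [Q [QQ ZE]]].
apply: (@xgetPex _ _ [set e | is_eigen_decomposition Z e]).
by exists (lam, Q); split=> //=; rewrite rank1_sumE.
Qed.

Lemma psdmx_conj_diag {R : realType} p (d : 'rV[R]_p) (Q : 'M[R]_p) :
  (forall i, 0 <= d 0 i) -> psdmx (Q *m diag_mx d *m Q^T).
Proof.
move=> d0; split; first by rewrite symmetricmxE !trmx_mul trmxK tr_diag_mx mulmxA.
move=> v; rewrite quad_form_frob -!mulmxA frob_innerC frob_inner_mull.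
set y := Q^T *m v; rewrite /frob_inner; apply: sumr_ge0 => i _.
rewrite big_ord1 mul_diag_mx !mxE -mulrA mulr_ge0//.
by rewrite -expr2 sqr_ge0.
Qed.

Lemma tr_succeq_nuI {R : realType} p (nu : R) (Y : 'M[R]_p) :
  succeq_nuI nu Y -> Y^T = Y.
Proof.
move=> [+ _]; rewrite symmetricmxE linearB /= tr_scalar_mx => /eqP YE.
by apply: (addIr (- nu%:M)).
Qed.

(** Let [lam i] be the eigenvalues of [Z]. In an eigenbasis of [Z] the matrix
    [Z - plus_part nu Z] is diagonal with the entries [min (lam i - nu) 0], while
    the diagonal entries of [Y - plus_part nu Z] are nonnegative wherever
    [lam i < nu]. *)
Lemma plus_partP {R : realType} p (nu : R) (Z : 'M[R]_p) : Z^T = Z ->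
  succeq_nuI nu (plus_part nu Z) /\
  forall Y, succeq_nuI nu Y ->
    frob_inner (Z - plus_part nu Z) (Y - plus_part nu Z) <= 0.
Proof.
move=> /eigen_decompositionP; rewrite /plus_part.
case: (eigen_decomposition Z) => lam Q [/= QQ ZE].
set mu := \row_i Num.max (lam 0 i) nu; rewrite rank1_sumE in ZE; rewrite !rank1_sumE.
have QQt : Q *m Q^T = 1%:M by apply: mulmx1C.
have nuE : nu%:M = Q *m diag_mx (const_mx nu) *m Q^T.
  by rewrite diag_const_mx mul_mx_scalar -scalemxAl QQt scalemx1.
split.
  rewrite /succeq_nuI nuE -mulmxBl -mulmxBr -raddfB.
  apply: psdmx_conj_diag => i; rewrite !mxE subr_ge0.
  by rewrite le_max lexx orbT.
move=> Y [_ Ynu]; rewrite {1}ZE.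
rewrite -mulmxBl -mulmxBr -raddfB -mulmxA frob_inner_mull.
rewrite frob_inner_mulr trmxK mulmxBr mulmxBl !mulmxA QQ mul1mx.
rewrite -(mulmxA _ Q^T Q) QQ mulmx1 frob_inner_diag.
apply: sumr_le0 => i _; rewrite /mu !mxE eqxx mulr1n.
have -> : \sum_j (Q^T *m Y) i j * Q j i =
    nu + ((col i Q)^T *m (Y - nu%:M) *m col i Q) 0 0.
  rewrite mulmxBr mulmxBl mul_mx_scalar -scalemxAl.
  have -> : (col i Q)^T *m col i Q = 1%:M.
    rewrite tr_col colE -row_mul; apply/matrixP => k l; rewrite !ord1.
    by rewrite mulmxA QQ mul1mx !mxE !eqxx.
  rewrite !mxE eqxx mulr1 [RHS]addrC subrK.
  apply: eq_bigr => j _; rewrite !mxE; congr (_ * _).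
  by apply: eq_bigr => k _; rewrite !mxE.
have := Ynu (col i Q); set q := (_ *m _) 0 0 => q0.
case: (leP (lam 0 i) nu) => lamnu; last by rewrite subrr mul0r.
by rewrite [nu + q]addrC addrK mulr_le0_ge0// subr_le0.
Qed.

Section projection.
Context {R : realType} {p : nat} (nu : R).
Implicit Types Z W Y : 'M[R]_p.

Definition sym_part Z : 'M[R]_p := 2^-1 *: (Z + Z^T).

Lemma tr_sym_part Z : (sym_part Z)^T = sym_part Z.
Proof. by rewrite /sym_part linearZ linearD /= trmxK addrC. Qed.

Lemma frob_sym_part Z Y : Y^T = Y -> frob_inner (sym_part Z) Y = frob_inner Z Y.
Proof.
move=> YY; rewrite /sym_part !frob_bilin -{2}YY frob_inner_tr; lra.
Qed.

(** [plus_part] is meaningful on symmetric matrices only; since the target set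
    consists of symmetric matrices, composing with [sym_part] gives the
    projection of an arbitrary matrix. *)
Definition proj Z := plus_part nu (sym_part Z).

Lemma proj_succeq Z : succeq_nuI nu (proj Z).
Proof. by have [] := plus_partP nu (tr_sym_part Z). Qed.

Lemma proj_varineq Z Y : succeq_nuI nu Y ->
  frob_inner (Z - proj Z) (Y - proj Z) <= 0.
Proof.
move=> Ynu; have [_ /(_ _ Ynu)] := plus_partP nu (tr_sym_part Z).
rewrite !frob_innerDl frob_sym_part// linearB /=.
by rewrite (tr_succeq_nuI Ynu) (tr_succeq_nuI (proj_succeq Z)).
Qed.

(** Add the variational inequalities of [Z] tested at [proj W] and of [W] tested
    at [proj Z]. *)
Lemma proj_nonexpansive Z W :
  frob_inner (proj Z - proj W) (proj Z - proj W) <= frob_inner (Z - W) (Z - W).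
Proof.
have zw := proj_varineq Z (proj_succeq W).
have wz := proj_varineq W (proj_succeq Z).
have := frob_inner_ge0 ((Z - W) - (proj Z - proj W)).
move: (proj Z) (proj W) zw wz => z w.
rewrite !frob_bilin (frob_innerC W Z) (frob_innerC w z).
rewrite (frob_innerC z Z) (frob_innerC w Z) (frob_innerC z W) (frob_innerC w W).
lra.
Qed.

End projection.

Lemma cvg_proj {R : realType} p (nu : R) I (F : set_system I) {FF : Filter F}
    (Z : I -> 'M[R]_p) z :
  Z x @[x --> F] --> z -> proj nu (Z x) @[x --> F] --> proj nu z.
Proof.
move=> Zz; apply: cvg_frob0.
apply: (@squeeze_cvgr _ _ _ _ (cst 0) (fun x => frob_inner (Z x - z) (Z x - z))).
- by apply: nearW => x; rewrite frob_inner_ge0 proj_nonexpansive.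
- exact: cvg_cst.
- rewrite -(frob_inner0r (0 : 'M[R]_p)) -(subrr z).
  by apply: cvg_frob_inner; apply: cvgB => //; exact: cvg_cst.
Qed.

(** * Subgradients of the off-diagonal norm and soft-thresholding *)

(** The subdifferential of [lambda *: offdiag_l1]. The factor [lambda] is kept
    inside the inequality, which makes [lambda = 0] an ordinary case. *)
Definition l1_subgrad {R : realType} p (lambda : R) (X G : 'M[R]_p) : Prop :=
  (forall j, G j j = 0) /\
  forall j l, j != l -> forall y,
    lambda * `|X j l| + G j l * (y - X j l) <= lambda * `|y|.

Lemma l1_subgrad_ineq {R : realType} p (lambda : R) (X G Y : 'M[R]_p) :
  l1_subgrad lambda X G ->
  lambda * offdiag_l1 X + frob_inner G (Y - X) <= lambda * offdiag_l1 Y.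
Proof.
move=> [G0 Gsub]; rewrite /offdiag_l1 /frob_inner !mulr_sumr -big_split/=.
apply: ler_sum => i _; rewrite !mulr_sumr [X in _ + X](bigD1 i)//= G0 mul0r add0r.
rewrite [X in _ + X](eq_bigl (fun j => i != j)); last by move=> j; rewrite eq_sym.
rewrite -big_split/=; apply: ler_sum => j ij.
by rewrite !mxE; exact: Gsub.
Qed.

Lemma l1_subgrad_monotone {R : realType} p (lambda : R) (X Y G H : 'M[R]_p) :
  l1_subgrad lambda X G -> l1_subgrad lambda Y H ->
  0 <= frob_inner (G - H) (X - Y).
Proof.
move=> /l1_subgrad_ineq-/(_ Y) + /l1_subgrad_ineq-/(_ X).
rewrite !frob_bilin; lra.
Qed.

Lemma soft_threshold_scalar {R : realType} (z d y : R) : 0 <= d ->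
  let x := Num.sg z * Num.max (`|z| - d) 0 in
  d * `|x| + (z - x) * (y - x) <= d * `|y|.
Proof.
move=> d0; set x := Num.sg z * _; rewrite /= -/x; have [zd|dz] := leP `|z| d.
  have -> : x = 0 by rewrite /x max_r ?mulr0// subr_le0.
  rewrite normr0 mulr0 add0r !subr0 (le_trans (ler_norm _))// normrM.
  exact: ler_wpM2r.
have z0 : z != 0 by rewrite -normr_gt0 (le_lt_trans d0).
have xE : x = z - d * Num.sg z.
  rewrite /x max_l ?subr_ge0 ?(ltW dz)//.
  by rewrite mulrBr -numEsg [_ * d]mulrC.
have -> : d * `|x| = d * (Num.sg z * x).
  have -> : Num.sg z * x = `|z| - d.
    by rewrite /x max_l ?subr_ge0 ?(ltW dz)// mulrA -expr2 sqr_sg z0 mul1r.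
  by rewrite /x normrM normr_sg z0 mul1r ger0_norm max_l// subr_ge0 ltW.
have -> : d * (Num.sg z * x) + (z - x) * (y - x) = d * (Num.sg z * y).
  by rewrite {2}xE; ring.
rewrite ler_wpM2l// (le_trans (ler_norm _))// normrM normr_sg z0 mul1r//.
Qed.

Lemma tr_soft_threshold {R : realType} p (W : 'M[R]_p) d :
  (soft_threshold W d)^T = soft_threshold W^T d.
Proof. by apply/matrixP => i j; rewrite !mxE eq_sym. Qed.

(** For [W = tau *: (S - Lam) + Phi] this is the first order condition for the
    minimum of the augmented Lagrangian in Sigma. *)
Lemma soft_threshold_subgrad {R : realType} p (lambda tau : R) (W : 'M[R]_p) :
  0 <= lambda -> 0 < tau ->
  l1_subgrad lambda ((tau + 1)^-1 *: soft_threshold W (lambda * tau))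
    (tau^-1 *: (W - soft_threshold W (lambda * tau))).
Proof.
move=> lam0 tau0; split=> [j|j l jl y]; first by rewrite !mxE eqxx subrr mulr0.
have t1 : 0 < tau + 1 by rewrite ltr_wpDr.
have := soft_threshold_scalar (W j l) ((tau + 1) * y) (mulr_ge0 lam0 (ltW tau0)).
rewrite !mxE (negbTE jl) /=; move: (W j l) (Num.sg _ * _) => z x.
rewrite !normrM (ger0_norm (ltW t1)) (@ger0_norm _ (tau + 1)^-1) ?invr_ge0 ?(ltW t1)//.
have k0 : 0 <= (tau * (tau + 1))^-1 by rewrite invr_ge0 mulr_ge0 ?ltW.
move=> /(ler_wpM2l k0); congr (_ <= _); field; by rewrite !gt_eqF.
Qed.

(** * Existence of a saddle point *)

(** The Karush-Kuhn-Tucker conditions at [Sigma = Phi = X]. *)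
Definition saddle_point {R : realType} p (nu lambda : R) (S X Lam : 'M[R]_p) :=
  [/\ l1_subgrad lambda X (- X + S - Lam), succeq_nuI nu X
    & forall Y, succeq_nuI nu Y -> frob_inner Lam (Y - X) <= 0].

(** The box is a product of intervals, so [G] can be tested entry by entry;
    replacing an entry by [lambda * Num.sg (X j l)] gives
    [lambda * `|X j l| <= G j l * X j l]. *)
Lemma box_maximizer_subgrad {R : realType} p (lambda : R) (X G : 'M[R]_p) :
  0 <= lambda ->
  (forall j l, `|G j l| <= lambda * (j != l)%:R) ->
  (forall H : 'M[R]_p, (forall j l, `|H j l| <= lambda * (j != l)%:R) ->
     frob_inner X (H - G) <= 0) ->
  l1_subgrad lambda X G.
Proof.
move=> lam0 Gbox Gmax; split=> [j|j l jl y].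
  by apply/eqP; have := Gbox j j; rewrite eqxx mulr0 normr_le0.
have Gjl : `|G j l| <= lambda by have := Gbox j l; rewrite jl mulr1.
pose H : 'M[R]_p := \matrix_(a, b)
  if (a == j) && (b == l) then lambda * Num.sg (X j l) else G a b.
have : frob_inner X (H - G) <= 0.
  apply: Gmax => a b; rewrite mxE; case: ifP => [/andP[/eqP-> /eqP->]|_ //].
  rewrite jl mulr1 normrM (ger0_norm lam0) normr_sg ler_piMr//.
  by case: (_ != 0).
have -> : frob_inner X (H - G) = X j l * (lambda * Num.sg (X j l) - G j l).
  rewrite /frob_inner (bigD1 j)//= (bigD1 l)//= !mxE !eqxx/=.
  rewrite big1 => [|b bl]; last by rewrite !mxE (negbTE bl) andbF subrr mulr0.
  rewrite big1 => [|a aj]; last first.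
    by apply: big1 => b _; rewrite !mxE (negbTE aj) subrr mulr0.
  by rewrite !addr0.
have := normrEsg (X j l); have : G j l * y <= lambda * `|y|.
  by rewrite (le_trans (ler_norm _))// normrM ler_wpM2r.
move: (Num.sg _) `|X j l| => s a; nra.
Qed.

(** The dual function [h G], the minimum over [Y] of
    [|Y - S|^2 / 2 + <G, Y>], is attained at [proj nu (S - G)]. It is
    maximized over the compact box of all possible subgradients. At a maximizer
    its gradient [proj nu (S - G)] makes no acute angle with any direction
    pointing into the box. *)
Lemma saddle_point_exists {R : realType} p (nu lambda : R) (S : 'M[R]_p) :
  0 <= lambda -> exists X Lam, saddle_point nu lambda S X Lam.
Proof.
move=> lam0.
pose box : set 'M[R]_p := [set G | forall j l, `|G j l| <= lambda * (j != l)%:R].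
pose pr G := proj nu (S - G).
pose L G Y := frob_inner (Y - S) (Y - S) / 2 + frob_inner G Y.
have pr_min G Y : succeq_nuI nu Y -> L G (pr G) <= L G Y.
  move=> /(proj_varineq (S - G)); rewrite -/(pr G) => ineq.
  have := frob_inner_ge0 (Y - pr G); move: ineq; rewrite /L; move: (pr G) => X.
  rewrite !frob_bilin (frob_innerC Y S) (frob_innerC X S) (frob_innerC X Y).
  lra.
have box0 : box !=set0.
  by exists 0 => j l; rewrite mxE normr0 mulr_ge0.
have [|G /set_mem Gbox Gmax] :=
    compact_EVT_max (f := fun G => L G (pr G)) box0 (@compact_mx_box R _ _ _).
  apply: continuous_subspaceT => G.
  have cpr : pr H @[H --> nbhs G] --> pr G.
    by apply: cvg_proj; apply: cvgB => //; exact: cvg_cst.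
  have cnorm : frob_inner (pr H - S) (pr H - S) @[H --> nbhs G] -->
      frob_inner (pr G - S) (pr G - S).
    by apply: cvg_frob_inner; apply: cvgB => //; exact: cvg_cst.
  apply: (@cvgD _ _ _ (nbhs G)); last exact: (@cvg_frob_inner R _ (nbhs G) _ _ _ id pr).
  by apply: (@cvgM _ _ (nbhs G)) => //; exact: cvg_cst.
exists (pr G), (S - G - pr G); split.
- rewrite (_ : - pr G + S - (S - G - pr G) = G); last first.
    by apply/matrixP => i j; rewrite !mxE; ring.
  apply: box_maximizer_subgrad => // H Hbox.
  set D := H - G.
  (* Compare the maximizer G with G + t D: the derivative of the dual function
     at t = 0 is the inner product of pr G and D, up to an error of order t. *)
  have small t : 0 < t -> t <= 1 -> frob_inner (pr G) D <= t * frob_inner D D.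
    move=> t0 t1; pose Gt := G + t *: D.
    have Gtbox : Gt \in box.
      apply/mem_set => j l; rewrite !mxE.
      have -> : G j l + t * (H j l - G j l) = (1 - t) * G j l + t * H j l by ring.
      rewrite (le_trans (ler_normD _ _))// !normrM (ger0_norm (ltW t0)).
      rewrite (@ger0_norm _ (1 - t)) ?subr_ge0//.
      move: (Hbox j l) (Gbox j l); move: `|H j l| `|G j l| (lambda * _) => h g b; nra.
    have DGt : frob_inner D (pr Gt) <= 0.
      have := le_trans (Gmax _ Gtbox) (pr_min G (pr Gt) (proj_succeq _ _)).
      have GtE Y : frob_inner Gt Y = frob_inner G Y + t * frob_inner D Y.
        by rewrite frob_innerDl frob_innerZl.
      by rewrite /L GtE addrA gerDl pmulr_rle0.
    have := proj_nonexpansive nu (S - G) (S - Gt).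
    have -> : S - G - (S - Gt) = t *: D.
      by rewrite /Gt; apply/matrixP => i j; rewrite !mxE; ring.
    rewrite -/(pr G) -/(pr Gt); set E := pr G - pr Gt => EE.
    have DE : frob_inner (pr G) D = frob_inner D (pr Gt) + frob_inner D E.
      by rewrite -frob_innerDr addrC subrK frob_innerC.
    rewrite frob_innerZl frob_innerZr in EE; have := frob_young t D E.
    rewrite DE; move: (frob_inner D E) => de; nra.
  rewrite leNgt; apply/negP => XD0.
  have DD0 := frob_inner_ge0 D.
  set c := frob_inner (pr G) D in XD0 small; set q := frob_inner D D in DD0 small.
  have cq0 : 0 < c + q by rewrite ltr_wpDr.
  have cq1 : 0 < 1 + c + q by rewrite -addrA ltr_wpDl.
  have := small (c / (1 + c + q)); rewrite divr_gt0//.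
  rewrite ler_pdivrMr// mul1r => /(_ isT).
  have -> : c <= 1 + c + q by lra.
  move=> /(_ isT); rewrite mulrAC ler_pdivlMr//.
  nra.
- exact: proj_succeq.
- by move=> Y; exact: proj_varineq.
Qed.

(** * Convergence of the iteration *)

(** Here [u] and [l] are the errors of Sigma and Lambda before a step, [u'] and
    [l'] those after it, and [u' + tau *: (l - l')] is the error of Phi. The
    hypotheses express monotonicity: of the Sigma-step and of the Phi-step
    against a saddle point, and of two consecutive Sigma-steps against each
    other. The last one bounds the cross term [<u - u', l - l'>] that remains
    when the other two are added. *)
Lemma fejer_inequality {R : realType} m n (tau : R) (u u' l l' : 'M[R]_(m, n)) :
  0 < tau ->
  frob_inner l' u' <= - frob_inner u' u' ->
  0 <= frob_inner (u + tau *: l - (u' + tau *: (l - l'))) (u' + tau *: (l - l')) ->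
  frob_inner (u - u') (l - l') <= - frob_inner (u - u') (u - u') ->
  (frob_inner u' u' + tau ^+ 2 * frob_inner l' l') +
    (2 * tau * frob_inner u' u' + tau ^+ 2 * frob_inner (l - l') (l - l'))
  <= frob_inner u u + tau ^+ 2 * frob_inner l l.
Proof.
move=> tau0 a b c.
have -> : frob_inner u u = frob_inner u' u' + 2 * frob_inner u' (u - u') +
    frob_inner (u - u') (u - u').
  by rewrite !frob_bilin (frob_innerC u' u); ring.
have -> : frob_inner l l = frob_inner l' l' + 2 * frob_inner l' (l - l') +
    frob_inner (l - l') (l - l').
  by rewrite !frob_bilin (frob_innerC l' l); ring.
have uE : u + tau *: l - (u' + tau *: (l - l')) = (u - u') + tau *: l'.
  by apply/matrixP => i j; rewrite !mxE; ring.
rewrite uE in b.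
have := frob_inner_ge0 (u - u').
move: (u - u') (l - l') b c => du dl; rewrite !frob_bilin.
rewrite (frob_innerC du u'); nra.
Qed.

Section admm.
Context {R : realType} {p : nat}.
Variables (nu lambda tau : R) (S : 'M[R]_p) (Sig Phi Lam : nat -> 'M[R]_p).
Hypotheses (lambda_ge0 : 0 <= lambda) (tau_gt0 : 0 < tau).
Hypotheses (symS : S^T = S) (symSig0 : (Sig 0)^T = Sig 0) (symLam0 : (Lam 0)^T = Lam 0).
Hypothesis PhiS : forall i, Phi i.+1 = plus_part nu (Sig i + tau *: Lam i).
Hypothesis SigS : forall i, Sig i.+1 = (tau + 1)^-1 *:
  soft_threshold (tau *: (S - Lam i) + Phi i.+1) (lambda * tau).
Hypothesis LamS : forall i, Lam i.+1 = Lam i - tau^-1 *: (Phi i.+1 - Sig i.+1).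

Lemma admm_sym i : (Sig i)^T = Sig i /\ (Lam i)^T = Lam i.
Proof.
elim: i => [//|i [symSig symLam]].
have symPhi : (Phi i.+1)^T = Phi i.+1.
  rewrite PhiS; apply: (@tr_succeq_nuI _ _ nu).
  have [] := @plus_partP _ _ nu (Sig i + tau *: Lam i) _ => //.
  by rewrite linearD linearZ /= symSig symLam.
have symSigS : (Sig i.+1)^T = Sig i.+1.
  rewrite SigS linearZ /= tr_soft_threshold.
  by rewrite linearD linearZ linearB /= symS symLam symPhi.
by split=> //; rewrite LamS linearB linearZ linearB /= symLam symPhi symSigS.
Qed.

Lemma admm_subgrad i : l1_subgrad lambda (Sig i.+1) (- Sig i.+1 + S - Lam i.+1).
Proof.
have := soft_threshold_subgrad (tau *: (S - Lam i) + Phi i.+1) lambda_ge0 tau_gt0.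
rewrite -SigS.
set s := soft_threshold _ _.
suff -> : tau^-1 *: (tau *: (S - Lam i) + Phi i.+1 - s) = - Sig i.+1 + S - Lam i.+1 by [].
have -> : s = (tau + 1) *: Sig i.+1.
  by rewrite SigS scalerA divff ?scale1r// gt_eqF// ltr_wpDr.
rewrite LamS; apply/matrixP => j l; rewrite !mxE; field.
by rewrite gt_eqF.
Qed.

Lemma admm_projection i : succeq_nuI nu (Phi i.+1) /\
  forall Y, succeq_nuI nu Y ->
    frob_inner (Sig i + tau *: Lam i - Phi i.+1) (Y - Phi i.+1) <= 0.
Proof.
rewrite PhiS; apply: plus_partP.
by have [symSig symLam] := admm_sym i; rewrite linearD linearZ /= symSig symLam.
Qed.

Lemma admm_Phi i : Phi i.+1 = Sig i.+1 + tau *: (Lam i - Lam i.+1).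
Proof.
rewrite LamS; apply/matrixP => j l; rewrite !mxE; field.
by rewrite gt_eqF.
Qed.

(** The Lyapunov function of the iteration. *)
Definition merit (X L : 'M[R]_p) (i : nat) :=
  frob_inner (Sig i - X) (Sig i - X) + tau ^+ 2 * frob_inner (Lam i - L) (Lam i - L).

Lemma merit_ge0 X L i : 0 <= merit X L i.
Proof.
apply: addr_ge0; first exact: frob_inner_ge0.
by apply: mulr_ge0; [exact: sqr_ge0|exact: frob_inner_ge0].
Qed.

(** The comparison of consecutive Sigma-steps needs [admm_subgrad] at both of
    them, which fails at the arbitrary starting point; hence [i.+1]. *)
Lemma merit_decrease X L i : saddle_point nu lambda S X L ->
  merit X L i.+2 +
    (2 * tau * frob_inner (Sig i.+2 - X) (Sig i.+2 - X) +
     tau ^+ 2 * frob_inner (Lam i.+1 - Lam i.+2) (Lam i.+1 - Lam i.+2))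
  <= merit X L i.+1.
Proof.
move=> [Lsub Xnu Lcone]; rewrite /merit.
have subE (A B C D : 'M[R]_p) : - A + S - B - (- C + S - D) = - (A - C) - (B - D).
  by apply/matrixP => j l; rewrite !mxE; ring.
have LamE : Lam i.+1 - Lam i.+2 = (Lam i.+1 - L) - (Lam i.+2 - L).
  by rewrite opprB addrA subrK.
have SigE : Sig i.+1 - Sig i.+2 = (Sig i.+1 - X) - (Sig i.+2 - X).
  by rewrite opprB addrA subrK.
have PhiE : Phi i.+2 - X = (Sig i.+2 - X) + tau *: (Lam i.+1 - L - (Lam i.+2 - L)).
  by rewrite admm_Phi -LamE addrAC.
rewrite LamE; apply: fejer_inequality => //.
- have := l1_subgrad_monotone (admm_subgrad i.+1) Lsub.
  rewrite subE; move: (Sig _ - X) (Lam _ - L) => u l.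
  rewrite !frob_bilin; lra.
- rewrite -PhiE.
  have [Phinu /(_ _ Xnu)] := admm_projection i.+1.
  have := Lcone _ Phinu; rewrite -(opprB _ X).
  have -> : Sig i.+1 + tau *: Lam i.+1 - Phi i.+2 =
    (Sig i.+1 - X + tau *: (Lam i.+1 - L) - (Phi i.+2 - X)) + tau *: L.
    by apply/matrixP => j l; rewrite !mxE; ring.
  rewrite frob_innerNr frob_innerDl frob_innerZl.
  move: (frob_inner L _) => b b0; rewrite oppr_le0 => h; apply: (le_trans h).
  by rewrite gerDl pmulr_rle0.
- rewrite -SigE -LamE.
  have := l1_subgrad_monotone (admm_subgrad i) (admm_subgrad i.+1).
  rewrite subE; move: (Sig _ - Sig _) (Lam _ - Lam _) => s l.
  rewrite !frob_bilin (frob_innerC l s); lra.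
Qed.

Lemma merit_cvg X L : saddle_point nu lambda S X L -> cvgn (fun i => merit X L i.+1).
Proof.
move=> XL; apply: nonincreasing_is_cvgn; last first.
  by exists 0 => _ [i _ <-]; exact: merit_ge0.
apply/nonincreasing_seqP => i; apply: le_trans (merit_decrease i XL).
by rewrite lerDl addr_ge0 ?mulr_ge0 ?frob_inner_ge0 ?sqr_ge0// ltW.
Qed.

(** The merit function converges, so its decrements tend to 0, and they dominate
    both residuals. *)
Lemma admm_residuals X L : saddle_point nu lambda S X L ->
  Sig i.+2 @[i --> \oo] --> X /\ Lam i.+1 - Lam i.+2 @[i --> \oo] --> (0 : 'M[R]_p).
Proof.
move=> XL; pose r i := merit X L i.+1 - merit X L i.+2.
have r0 : r i @[i --> \oo] --> 0.
  have E1 := merit_cvg XL; rewrite -(subrr (limn (fun i => merit X L i.+1))).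
  apply: cvgB => //.
  by rewrite (@cvg_shiftS _ (fun i => merit X L i.+1)).
have cr0 (c : R) : c * r i @[i --> \oo] --> 0.
  by rewrite -(mulr0 c); apply: cvgM => //; exact: cvg_cst.
have dec i := merit_decrease i XL.
split; apply: cvg_frob0.
- apply: (squeeze_cvgr _ (cvg_cst 0) (cr0 (2 * tau)^-1)); apply: nearW => i.
  rewrite frob_inner_ge0 /= ler_pdivlMl ?mulr_gt0// lerBrDl.
  by rewrite (le_trans _ (dec i))// lerD2l lerDl mulr_ge0 ?sqr_ge0 ?frob_inner_ge0.
- apply: (squeeze_cvgr _ (cvg_cst 0) (cr0 (tau ^+ 2)^-1)); apply: nearW => i.
  rewrite subr0 frob_inner_ge0 /= ler_pdivlMl ?exprn_gt0// lerBrDl.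
  rewrite (le_trans _ (dec i))// lerD2l lerDr mulr_ge0 ?frob_inner_ge0//.
  by rewrite mulr_ge0// ltW.
Qed.

(** The multipliers stay bounded and the optimality conditions are closed, so
    an ultrafilter limit of them is again an optimal multiplier. With respect
    to it the monotone merit function tends to 0. *)
Lemma admm_cvg X L : saddle_point nu lambda S X L ->
  exists L', [/\ saddle_point nu lambda S X L',
    Sig i @[i --> \oo] --> X, Phi i @[i --> \oo] --> X & Lam i @[i --> \oo] --> L'].
Proof.
move=> XL; have [cSig cLam] := admm_residuals XL.
have cPhi : Phi i.+2 @[i --> \oo] --> X.
  rewrite -[X]addr0 -(scaler0 _ tau).
  under eq_fun do rewrite admm_Phi.
  by apply: cvgD => //; apply: cvgZr.
have [U [UU ooU]] := ultraFilterLemma (eventually_filter : ProperFilter \oo).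
have toU (f : nat -> 'M[R]_p) (l : 'M[R]_p) :
    f i @[i --> \oo] --> l -> f i @[i --> U] --> l.
  by move=> fl V /fl /ooU.
have merit_le i : merit X L i.+1 <= merit X L 1.
  elim: i => // i; apply: le_trans; apply: le_trans (merit_decrease i XL).
  by rewrite lerDl addr_ge0 ?mulr_ge0 ?frob_inner_ge0 ?sqr_ge0// ltW.
pose b (j l : 'I_p) := `|L j l| + (merit X L 1 / tau ^+ 2 + 1).
have [|L' _ LamL'] :=
    ultra_cvg_compact UU (u := fun i => Lam i.+2) (compact_mx_box (b := b)).
  apply: ooU.
  exists 0%N => // i _ j l; rewrite /b -[Lam _ _ _](subrK (L j l)) addrC.
  rewrite (le_trans (ler_normD _ _))// lerD2l.
  have : (Lam i.+2 j l - L j l) ^+ 2 <= merit X L 1 / tau ^+ 2.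
    have := sqr_coord_le (Lam i.+2 - L) j l; rewrite !mxE => /le_trans; apply.
    rewrite ler_pdivlMr ?exprn_gt0// mulrC.
    by rewrite (le_trans _ (merit_le i.+1))// lerDr frob_inner_ge0.
  rewrite -[X in X <= _]real_normK ?num_real//.
  by have := normr_ge0 (Lam i.+2 j l - L j l); nra.
have XL' : saddle_point nu lambda S X L'.
  have [_ Xnu _] := XL; split=> //.
    have cG : - Sig i.+2 + S - Lam i.+2 @[i --> U] --> - X + S - L'.
      apply: cvgB => //; apply: cvgD; last exact: cvg_cst.
      by apply: cvgN; exact: toU.
    move/cvg_mxP : cG => cG.
    have /cvg_mxP cSigU := toU _ _ cSig.
    split=> [j|j l jl y].
      apply: (cvgr_unique (cG j j)).
      under eq_fun do rewrite (admm_subgrad _).1.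
      exact: cvg_cst.
    apply: (@ler_cvg_to _ U _ _ (fun i => lambda * `|Sig i.+2 j l| +
      (- Sig i.+2 + S - Lam i.+2) j l * (y - Sig i.+2 j l)) (cst (lambda * `|y|))).
    - apply: cvgD; first by apply: cvgM; [exact: cvg_cst|apply: cvg_norm].
      by apply: cvgM => //; apply: cvgB => //; exact: cvg_cst.
    - exact: cvg_cst.
    - by apply: nearW => i; exact: (admm_subgrad _).2.
  move=> Y Ynu; rewrite -(@pmulr_rle0 _ tau)// -frob_innerZl.
  have cV : Sig i.+2 + tau *: Lam i.+2 - Phi i.+3 @[i --> U] --> tau *: L'.
    have -> : tau *: L' = X + tau *: L' - X by rewrite addrAC subrr add0r.
    apply: cvgB; last by apply: toU; rewrite (@cvg_shiftS _ (fun i => Phi i.+2)).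
    by apply: cvgD; [exact: toU|apply: cvgZr].
  apply: (@ler_cvg_to _ U _ _ (fun i => frob_inner
    (Sig i.+2 + tau *: Lam i.+2 - Phi i.+3) (Y - Phi i.+3)) (cst 0)).
  - apply: cvg_frob_inner => //; apply: cvgB; first exact: cvg_cst.
    by apply: toU; rewrite (@cvg_shiftS _ (fun i => Phi i.+2)).
  - exact: cvg_cst.
  - by apply: nearW => i; exact: (admm_projection _).2.
have shift2 (f : nat -> 'M[R]_p) (l : 'M[R]_p) :
    f i.+2 @[i --> \oo] --> l -> f i @[i --> \oo] --> l.
  by move=> fl; rewrite -(@cvg_shiftS _ f) -(@cvg_shiftS _ (fun i => f i.+1)).
exists L'; split=> //.
- exact: shift2.
- exact: shift2.
- apply: shift2; apply: cvg_frob0.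
  have mcvg := merit_cvg XL'.
  have mU : merit X L' i.+2 @[i --> U] --> 0.
    have dif (A : nat -> 'M[R]_p) (a : 'M[R]_p) : A i @[i --> U] --> a ->
        frob_inner (A i - a) (A i - a) @[i --> U] --> 0.
      move=> Aa; rewrite -(frob_inner0r (0 : 'M[R]_p)) -(subrr a).
      by apply: cvg_frob_inner; apply: cvgB => //; exact: cvg_cst.
    rewrite -[X in _ --> X]addr0 -[X in _ + X](mulr0 (tau ^+ 2)).
    apply: cvgD; first exact/dif/toU.
    by apply: cvgM; [exact: cvg_cst|exact: dif].
  have {}mcvg : merit X L' i.+2 @[i --> \oo] --> limn (fun i => merit X L' i.+1).
    by rewrite (@cvg_shiftS _ (fun i => merit X L' i.+1)).
  have m0 : limn (fun i => merit X L' i.+1) = 0.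
    by apply: (cvgr_unique _ mU) => V /mcvg /ooU.
  rewrite m0 in mcvg.
  have cm : (tau ^+ 2)^-1 * merit X L' i.+2 @[i --> \oo] --> 0.
    by rewrite -(mulr0 (tau ^+ 2)^-1); apply: cvgM => //; exact: cvg_cst.
  apply: (squeeze_cvgr _ (cvg_cst 0) cm); apply: nearW => i.
  rewrite frob_inner_ge0 /= ler_pdivlMl ?exprn_gt0//.
  by rewrite lerDr frob_inner_ge0.
Qed.

End admm.

(** * Optimality of saddle points *)

Lemma l1_subgrad_subdifferential {R : realType} (lambda x g : R) :
  0 <= lambda -> (forall y, lambda * `|x| + g * (y - x) <= lambda * `|y|) ->
  exists2 h, subdifferential Num.norm x h & lambda * h = g.
Proof.
rewrite le_eqVlt => /predU1P[<- gx|lam0 gx].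
  (* For lambda = 0 the inequality forces g = 0, and any subgradient does. *)
  exists (Num.sg x).
    move=> y /=; rewrite mulrBr -normrEsg addrC subrK.
    rewrite (le_trans (ler_norm _))// normrM normr_sg ler_piMl//.
    by case: (_ != 0).
  have := gx (x + g); rewrite !mul0r add0r addrC addKr -expr2 => g2.
  by apply/eqP; rewrite eq_sym -sqrf_eq0 eq_le g2 sqr_ge0.
exists (g / lambda); last by rewrite mulrC divfK// gt_eqF.
move=> y /=; rewrite -(ler_pM2l lam0) mulrDr mulrA (mulrCA lambda) divff ?gt_eqF// mulr1.
exact: gx.
Qed.

Section optimality.
Context {R : realType} {p M : nat}.
Variables (Sighat : 'I_M -> 'M[R]_p) (nu lambda : R).
Hypotheses (M_gt0 : (0 < M)%N) (lambda_ge0 : 0 <= lambda).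

Lemma quadratic_loss_expand (X Y : 'M[R]_p) :
  (2 * M%:R)^-1 * (\sum_k frob_norm (Y - Sighat k) ^+ 2) =
  (2 * M%:R)^-1 * (\sum_k frob_norm (X - Sighat k) ^+ 2) +
  frob_inner (Y - X) (Y - X) / 2 + frob_inner (X - mean_estimate Sighat) (Y - X).
Proof.
have M0 : M%:R != 0 :> R by rewrite pnatr_eq0 -lt0n.
set D := Y - X.
have -> : \sum_k frob_norm (Y - Sighat k) ^+ 2 =
    \sum_k frob_norm (X - Sighat k) ^+ 2 + M%:R * frob_inner D D +
    2 * \sum_k frob_inner D (X - Sighat k).
  rewrite (eq_bigr (fun k => frob_norm (X - Sighat k) ^+ 2 + frob_inner D D +
      2 * frob_inner D (X - Sighat k))) => [|k _].
    by rewrite !big_split /= sumr_const card_ord -mulr_sumr [M%:R * _]mulr_natl.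
  have -> : Y - Sighat k = D + (X - Sighat k) by rewrite /D addrA subrK.
  rewrite !frob_norm_sqr frob_innerDl !(frob_innerDr D) (frob_innerC (X - _) D).
  ring.
rewrite -frob_inner_sumr sumrB sumr_const card_ord.
have -> : \sum_k Sighat k = M%:R *: mean_estimate Sighat.
  by rewrite /mean_estimate scalerA divff ?scale1r.
rewrite -[X *+ M]scaler_nat -scalerBr frob_innerZr (frob_innerC D).
by field.
Qed.

Lemma saddle_point_minimizes (X L Y : 'M[R]_p) :
  saddle_point nu lambda (mean_estimate Sighat) X L -> succeq_nuI nu Y ->
  objective Sighat lambda X <= objective Sighat lambda Y.
Proof.
move=> [Lsub _ Lcone] /Lcone LY.
rewrite /objective (quadratic_loss_expand X Y).
have := l1_subgrad_ineq Y Lsub; have := frob_inner_ge0 (Y - X); move: LY.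
move: (Y - X) => D.
have -> : - X + mean_estimate Sighat - L = - (X - mean_estimate Sighat) - L.
  by rewrite opprB [- X + _]addrC.
rewrite !frob_innerDl !frob_innerNl !frob_innerDl !frob_innerNl; lra.
Qed.

Lemma saddle_point_optimal_solution (X L : 'M[R]_p) :
  saddle_point nu lambda (mean_estimate Sighat) X L ->
  optimal_solution Sighat nu lambda X X.
Proof.
move=> XL; have [_ Xnu _] := XL; split.
  by split=> //; rewrite symmetricmxE (tr_succeq_nuI Xnu).
by move=> Y Y' [_ -> Ynu]; exact: (saddle_point_minimizes XL Ynu).
Qed.

Lemma saddle_point_primal_dual_optimal (X L : 'M[R]_p) : L^T = L ->
  saddle_point nu lambda (mean_estimate Sighat) X L ->
  primal_dual_optimal Sighat nu lambda X X L.
Proof.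
move=> symL [[Gdiag Gsub] Xnu Lcone]; split=> //.
- by split; rewrite symmetricmxE ?symL// (tr_succeq_nuI Xnu).
- move=> j l jl; apply/mem_set.
  exact: l1_subgrad_subdifferential lambda_ge0 (Gsub j l jl).
Qed.

End optimality.

Lemma tr_order_estimate {R : realType} n p (X : 'M[R]_(n, p)) s eta S :
  is_order_estimate X s eta S -> S^T = S.
Proof.
move=> [L [E [_ _ _ _ ->]]].
by rewrite !trmx_mul !trmxK tr_diag_mx !mulmxA.
Qed.

Lemma tr_mean_estimate {R : realType} p M (Sighat : 'I_M -> 'M[R]_p) :
  (forall k, (Sighat k)^T = Sighat k) ->
  (mean_estimate Sighat)^T = mean_estimate Sighat.
Proof.
move=> sym; rewrite /mean_estimate linearZ raddf_sum /=.
by congr (_ *: _); apply: eq_bigr => k _.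
Qed.

Lemma cvg_symmetric {R : realType} p (A : nat -> 'M[R]_p) (B : 'M[R]_p) :
  (forall i, (A i)^T = A i) -> A i @[i --> \oo] --> B -> B^T = B.
Proof.
move=> symA /cvg_mxP AB; apply/matrixP => j l; rewrite mxE.
apply: (cvgr_unique (AB l j)); rewrite (_ : (fun i => A i l j) = fun i => A i j l) //.
by apply/funext => i; rewrite -[in LHS]symA mxE.
Qed.

Unset Implicit Arguments.
Set Strict Implicit.

Theorem theorem1 (R : realType) (d : measure_display) (T : measurableType d)
    (P : probability T R) (n p M : nat)
    (x : 'I_n -> {RV P >-> p.-tuple R}) (Sigma : 'M[R]_p)
    (hx : iid_normal_sample x Sigma)
    (M_gt0 : (0 < M)%N)
    (pi : 'I_M -> 'S_p) (pi_inj : injective pi)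
    (eta : 'I_M -> 'I_p -> R) (eta_ge0 : forall k j, 0 <= eta k j)
    (w : T) (Sighat : 'I_M -> 'M[R]_p)
    (hSighat : forall k,
      is_order_estimate (data_matrix x w) (pi k) (eta k) (Sighat k))
    (nu lambda tau : R) (nu_gt0 : 0 < nu) (lambda_ge0 : 0 <= lambda)
    (tau_gt0 : 0 < tau)
    (Sig Phi Lam : nat -> 'M[R]_p)
    (Sig0_sym : Sig 0%N \is symmetricmx) (Lam0_sym : Lam 0%N \is symmetricmx)
    (hadmm : admm_iteration Sighat nu lambda tau Sig Phi Lam) :
  exists Sigp Phip Lamp : 'M[R]_p,
    [/\ [/\ Sig i @[i --> \oo] --> Sigp,
            Phi i @[i --> \oo] --> Phip
          & Lam i @[i --> \oo] --> Lamp],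
        optimal_solution Sighat nu lambda Sigp Phip
      & primal_dual_optimal Sighat nu lambda Sigp Phip Lamp].
Proof.
have symSighat k := tr_order_estimate (hSighat k).
have symS := tr_mean_estimate symSighat.
have symSig0 : (Sig 0%N)^T = Sig 0%N by apply/eqP; rewrite -symmetricmxE.
have symLam0 : (Lam 0%N)^T = Lam 0%N by apply/eqP; rewrite -symmetricmxE.
have PhiS i : Phi i.+1 = plus_part nu (Sig i + tau *: Lam i) by case: (hadmm i).
have SigS i : Sig i.+1 = (tau + 1)^-1 *:
    soft_threshold (tau *: (mean_estimate Sighat - Lam i) + Phi i.+1) (lambda * tau).
  by case: (hadmm i).
have LamS i : Lam i.+1 = Lam i - tau^-1 *: (Phi i.+1 - Sig i.+1) by case: (hadmm i).
have [X [L XL]] := saddle_point_exists nu (mean_estimate Sighat) lambda_ge0.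
have [L' [XL' cSig cPhi cLam]] :=
  admm_cvg lambda_ge0 tau_gt0 symS symSig0 symLam0 PhiS SigS LamS XL.
have symL' : L'^T = L'.
  apply: (cvg_symmetric _ cLam) => i.
  by have [] := admm_sym symS symSig0 symLam0 PhiS SigS LamS i.
exists X, X, L'; split; first by split.
- exact: (saddle_point_optimal_solution M_gt0 XL').
- exact: (saddle_point_primal_dual_optimal lambda_ge0 symL' XL').
Qed.
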